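(* Let $\mathcal N_j$ be a finite nonempty index set, $w_j\in\mathbb R$, and $a_i>0$ for all $i\in\mathcal N_j$, and let $H^j:=w_j\,ee^\top+\mathrm{diag}(a^j)$, where $a^j:=(a_i)_{i\in\mathcal N_j}$ and $e$ is the all-ones vector of length $|\mathcal N_j|$. Then $H^j$ is positive definite if and only if $1+w_j\sum_{i\in\mathcal N_j}\frac1{a_i}>0$.
   Context: $H^j$ is the Hessian of the function $f_j((x_i)_{i\in\mathcal N_j})=\frac12w_j\big(\sum_{i\in\mathcal N_j}x_i\big)^2+\sum_{i\in\mathcal N_j}\big(\frac12a_ix_i^2+b_ix_i\big)$ (with $b_i\in\mathbb R$). *)

(* Defs.v *)
From mathcomp Require Import all_boot all_order all_algebra.
From mathcomp Require Import reals.

Set Implicit Arguments.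
Unset Strict Implicit.
Unset Printing Implicit Defensive.

Import Order.TTheory GRing.Theory Num.Theory.
Local Open Scope ring_scope.

(* For real matrices; symmetry is part of the definition. *)
Definition posdefmx (R : realType) (n : nat) (A : 'M[R]_n) : Prop :=
  A \is symmetricmx /\
  forall x : 'cV[R]_n, x != 0 -> 0 < (x^T *m A *m x) 0 0.

(* A family indexed by N is turned into a vector of length #|N| through the
   enumeration enum_val : 'I_#|N| -> T of N; values of a outside N are unused. *)
Definition vec_on (R : realType) (T : finType) (N : {set T}) (a : T -> R) :
    'rV[R]_#|N| :=
  \row_(k < #|N|) a (enum_val k).

Definition onesv (R : realType) (n : nat) : 'cV[R]_n := const_mx 1.
Arguments onesv {R} n.

Definition Hmx (R : realType) (T : finType) (N : {set T}) (w : R) (a : T -> R) :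
    'M[R]_#|N| :=
  w *: (onesv #|N| *m (onesv #|N|)^T) + diag_mx (vec_on N a).

(* Main.v *)
Require Import Defs.
From mathcomp Require Import all_boot all_order all_algebra.
From mathcomp Require Import reals.
From mathcomp Require Import ring.

Import Order.TTheory GRing.Theory Num.Theory.
Local Open Scope ring_scope.

(** The quadratic form of [H] is [w s^2 + Q] with [s] the sum of the [x_i] and
    [Q] the sum of the [a_i x_i^2].  With [S] the sum of the [1 / a_i],
    Cauchy-Schwarz gives [s^2 <= S Q], so the form is at least
    [min(1, 1 + w S) Q]; at [x_i = 1 / a_i], the equality case, the form
    is [S (1 + w S)]. *)

Lemma symmetric_ones_add_diag (R : realType) (n : nat) (w : R) (d : 'rV[R]_n) :
  w *: (onesv n *m (onesv n)^T) + diag_mx d \is symmetricmx.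
Proof.
(* [symmetricmx] is the hermitian predicate with sign [(-1) ^+ 0] and the identity as conjugation;
   both are cleared before transposing. *)
apply/is_hermitianmxP.
by rewrite expr0 scale1r map_mx_id // linearD /= linearZ /= trmx_mul trmxK
  tr_diag_mx.
Qed.

Lemma quad_ones_add_diag (R : realType) (n : nat) (w : R) (d : 'rV[R]_n)
    (x : 'cV[R]_n) :
  (x^T *m (w *: (onesv n *m (onesv n)^T) + diag_mx d) *m x) 0 0 =
  w * (\sum_i x i 0) ^+ 2 + \sum_i d 0 i * x i 0 ^+ 2.
Proof.
have tx1 : (x^T *m onesv n) 0 0 = \sum_i x i 0.
  by rewrite mxE; apply: eq_bigr => i _; rewrite !mxE mulr1.
have t1x : ((onesv n)^T *m x) 0 0 = \sum_i x i 0.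
  by rewrite mxE; apply: eq_bigr => i _; rewrite !mxE mul1r.
rewrite mulmxDr mulmxDl -scalemxAr -scalemxAl 2!mxE.
(* Regrouped as [(x^T e) (e^T x)], the rank-one term is a product of two 1 by 1 matrices, so its
   entry is the product of their entries. *)
rewrite mulmxA -(mulmxA (x^T *m onesv n)) [X in w * X]mxE big_ord1.
rewrite tx1 t1x -expr2; congr (_ + _).
rewrite mxE; apply: eq_bigr => i _.
by rewrite mul_mx_diag !mxE; ring.
Qed.

(** Equality occurs when [x] is proportional to the [1 / a_i]. The deviations from that case, scaled
    by [S] to clear the denominator, are [S x_i - s / a_i]; the sum of their squares weighted by
    [a_i] is [S (S Q - s^2)], and a positive [S] can be cancelled. *)
Lemma sqr_sum_le_weighted (R : realFieldType) (I : finType) (a x : I -> R) :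
  (forall i, 0 < a i) ->
  (\sum_i x i) ^+ 2 <= (\sum_i (a i)^-1) * \sum_i a i * x i ^+ 2.
Proof.
move=> a_gt0; set S := \sum_i (a i)^-1; set s := \sum_i x i.
set Q := \sum_i a i * x i ^+ 2.
have S_ge0 : 0 <= S by apply: sumr_ge0 => i _; rewrite invr_ge0 ltW.
(* [S = 0] forces [I] to be empty: any index would have a positive [1 / a_i] that must vanish. *)
have [S0|S_neq0] := eqVneq S 0.
  suff -> : s = 0 by rewrite S0 mul0r expr0n.
  apply: big1 => i _; have := a_gt0 i; rewrite -invr_gt0.
  by rewrite (psumr_eq0P _ S0) ?ltxx // => j _; rewrite invr_ge0 ltW.
have expand : \sum_i a i * (S * x i - s / a i) ^+ 2 = S * (S * Q - s ^+ 2).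
  transitivity (\sum_i (S ^+ 2 * (a i * x i ^+ 2) - 2 * S * s * x i
                        + s ^+ 2 * (a i)^-1)).
    by apply: eq_bigr => i _; field; rewrite gt_eqF.
  by rewrite big_split sumrB /= -!mulr_sumr -/S -/s -/Q; ring.
have: 0 <= S * (S * Q - s ^+ 2).
  by rewrite -expand; apply: sumr_ge0 => i _; rewrite mulr_ge0 ?sqr_ge0 ?ltW.
by rewrite pmulr_rge0 ?subr_ge0// lt_def S_neq0.
Qed.

Lemma posdef_ones_add_diag (R : realType) (n : nat) (w : R) (d : 'rV[R]_n) :
    (0 < n)%N -> (forall i, 0 < d 0 i) ->
  posdefmx (w *: (onesv n *m (onesv n)^T) + diag_mx d) <->
  0 < 1 + w * \sum_i (d 0 i)^-1.
Proof.
move=> n_gt0 d_gt0; set S := \sum_i (d 0 i)^-1.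
have S_gt0 : 0 < S.
  rewrite /S (bigD1 (Ordinal n_gt0)) //= ltr_pwDl ?invr_gt0 //.
  by apply: sumr_ge0 => i _; rewrite invr_ge0 ltW.
split=> [[_ Hpos]|wS_gt0].
  have x_neq0 : \col_i (d 0 i)^-1 != 0 :> 'cV[R]_n.
    apply/eqP => /matrixP/(_ (Ordinal n_gt0) 0)/eqP.
    by rewrite !mxE invr_eq0 gt_eqF.
  have := Hpos _ x_neq0; rewrite quad_ones_add_diag.
  under eq_bigr do rewrite mxE.
  under [X in _ + X]eq_bigr => i _ do
    rewrite mxE expr2 mulrA divff ?gt_eqF// mul1r.
  rewrite -/S (_ : w * S ^+ 2 + S = S * (1 + w * S)); last by ring.
  by rewrite pmulr_rgt0.
split=> [|x x_neq0]; first exact: symmetric_ones_add_diag.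
rewrite quad_ones_add_diag.
have le_sSQ := @sqr_sum_le_weighted R _ (d 0) (x^~ 0) d_gt0.
move: le_sSQ; rewrite -/S; set s := \sum_i _; set Q := \sum_i _ => le_sSQ.
have term_ge0 i : 0 <= d 0 i * x i 0 ^+ 2 by rewrite mulr_ge0 ?sqr_ge0 ?ltW.
have Q_gt0 : 0 < Q.
  have [i xi_neq0] : exists i, x i 0 != 0 by apply/cV0Pn.
  rewrite /Q (bigD1 i) //= ltr_pwDl ?sumr_ge0 // mulr_gt0 //.
  by rewrite exprn_even_gt0.
(* For [w >= 0] the form is at least [Q]. For [w < 0], multiplying [s^2 <= S Q] by [w] reverses it,
   so the form is at least [(1 + w S) Q]. *)
have [w_ge0|w_lt0] := leP 0 w.
  by rewrite ltr_wpDl // mulr_ge0 ?sqr_ge0.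
have: 0 < (1 + w * S) * Q by rewrite mulr_gt0.
move/lt_le_trans; apply.
by rewrite mulrDl mul1r addrC lerD2r -mulrA ler_wnM2l // ltW.
Qed.

Theorem lemma1 (R : realType) (T : finType) (N : {set T}) (w : R) (a : T -> R)
    (hN : N != set0) (ha : forall i : T, i \in N -> 0 < a i) :
  posdefmx (Hmx N w a) <-> 0 < 1 + w * \sum_(i in N) (a i)^-1.
Proof.
(* Reindexing along [enum_val] moves the sum from [N] to the coordinates of the vector; [N != set0]
   then becomes positivity of the dimension. *)
have -> : \sum_(i in N) (a i)^-1 = \sum_k (vec_on N a 0 k)^-1.
  by rewrite big_enum_val; apply: eq_bigr => k _; rewrite mxE.
apply: posdef_ones_add_diag => [|k]; first by rewrite card_gt0.
by rewrite mxE ha ?enum_valP.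
Qed.
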